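(* Let $v$ be an RGF and let $\bar v=1(v+1)$. Then for every integer $n\ge 1$, $$\mathrm{LS}_n(\bar v)=\sum_{j=0}^{n-1}\binom{n-1}{j}q^j\,\mathrm{LS}_j(v)$$ and $$\mathrm{RS}_n(\bar v)=\sum_{j=0}^{n-1}\sum_{k=0}^{j}\binom{n+k-j-2}{k}q^k\,\mathrm{RS}_j(v).$$
   Context: A restricted growth function (RGF) of length $n$ is a sequence $w=w_1\dots w_n$ of positive integers with $w_1=1$ and $w_i\le 1+\max\{w_1,\dots,w_{i-1}\}$ for $i\ge 2$; $R_0$ consists of the empty word and $R_n$ is the set of RGFs of length $n$. For a word $w$ and integer $k\ge 0$, $w+k$ is obtained by adding $k$ to every letter of $w$, and $1(v+1)$ denotes the concatenation of the letter $1$ with $v+1$. The standardization of a word replaces every occurrence of its smallest letter by $1$, of its next smallest letter by $2$, and so on. An RGF $w$ contains an RGF $v$ if some subword (subsequence, not necessarily consecutive) of $w$ standardizes to $v$; otherwise $w$ avoids $v$. $R_n(v)$ is the set of $w\in R_n$ avoiding $v$. For a word $w$ and position $j$: $\mathrm{ls}(w_j)$ is the number of distinct values $w_i$ with $i<j$ and $w_i<w_j$; $\mathrm{rs}(w_j)$ is the number of distinct values $w_i$ with $i>j$ and $w_i<w_j$; statistics of $w$ are sums over $j$. $\mathrm{LS}_n(v)=\sum_{w\in R_n(v)}q^{\mathrm{ls}(w)}$, $\mathrm{RS}_n(v)=\sum_{w\in R_n(v)}q^{\mathrm{rs}(w)}$. Binomial convention: $\binom{a}{0}=1$ for all integers $a\ge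 -1$, and $\binom{a}{k}=0$ if $0\le a<k$. *)

(* Defs.v *)
From mathcomp Require Import all_boot all_order all_algebra.

Set Implicit Arguments.
Unset Strict Implicit.
Unset Printing Implicit Defensive.

Import GRing.Theory.

(* Words are sequences of naturals; position i of the code (from 0) is
   position i + 1 of the mathematical word. *)
Definition word := seq nat.

Definition shift (k : nat) (w : word) : word := [seq x + k | x <- w].

Definition is_rgf (w : word) : bool :=
  [&& all (leq 1) w, head 1 w == 1
    & all (fun i => nth 0 w i <= 1 + \max_(x <- take i w) x)
          (iota 1 (size w).-1)].

Definition standardize (w : word) : word :=
  [seq (index x (sort leq (undup w))).+1 | x <- w].

(* The subwords of w are the words mask m w. *)
Definition contains (w v : word) : bool :=
  [exists m : (size w).-tuple bool, standardize (mask m w) == v].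

Definition avoids (w v : word) : bool := ~~ contains w v.

Lemma containsP (w v : word) :
  reflect (exists2 u, subseq u w & standardize u = v) (contains w v).
Proof.
apply: (iffP existsP) => [[m /eqP <-]|[u /subseqP [m sz_m ->] <-]].
  by exists (mask m w) => //; exact: mask_subseq.
by exists (tcast sz_m (in_tuple m)); rewrite val_tcast.
Qed.

(* A letter of an RGF of length n is at most n (rgf_letter_le), so the RGFs of
   length n are found among the n-tuples over {0, ..., n}. *)
Definition word_of (n : nat) (t : n.-tuple 'I_n.+1) : word :=
  [seq val x | x <- t].

Definition R (n : nat) (v : word) : {set n.-tuple 'I_n.+1} :=
  [set t | is_rgf (word_of t) && avoids (word_of t) v].

Lemma rgf_letter_le (w : word) (x : nat) : is_rgf w -> x \in w -> x <= size w.
Proof.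
case/and3P=> _ /eqP w1 /allP wmax.
have le_nth i : i < size w -> nth 0 w i <= i.+1.
  elim/ltn_ind: i => [[|i]] IHi lt_i.
    by case: (w) w1 lt_i => //= a s ->.
  have /wmax : i.+1 \in iota 1 (size w).-1.
    by rewrite mem_iota /= add1n prednK //; apply: leq_ltn_trans lt_i.
  move/leq_trans; apply; rewrite add1n ltnS.
  apply/bigmax_leqP_seq => y /(nthP 0) [j]; rewrite size_take lt_i => lt_j <- _.
  have lt_jw := ltn_trans lt_j lt_i.
  by rewrite nth_take // (leq_trans (IHi _ lt_j lt_jw)).
by case/(nthP 0) => i lt_i <-; apply: leq_trans (le_nth i lt_i) lt_i.
Qed.

Lemma mem_R (n : nat) (v w : word) :
  (exists2 t, t \in R n v & word_of t = w) <->
  [/\ size w = n, is_rgf w & avoids w v].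
Proof.
split=> [[t + <-]|[sz_w rgf_w av_w]].
  by rewrite inE => /andP[-> ->]; rewrite size_map size_tuple.
have sz : size [seq inord x : 'I_n.+1 | x <- w] == n by rewrite size_map sz_w.
have tE : word_of (Tuple sz) = w.
  rewrite /word_of /= -map_comp -[RHS]map_id; apply/eq_in_map => x xw /=.
  by rewrite inordK // ltnS -sz_w rgf_letter_le.
by exists (Tuple sz); rewrite // inE tE rgf_w.
Qed.

Definition ls_at (w : word) (j : nat) : nat :=
  size (undup [seq x <- take j w | x < nth 0 w j]).

Definition rs_at (w : word) (j : nat) : nat :=
  size (undup [seq x <- drop j.+1 w | x < nth 0 w j]).

Definition ls (w : word) : nat := \sum_(j < size w) ls_at w j.
Definition rs (w : word) : nat := \sum_(j < size w) rs_at w j.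

(* The variable q is the indeterminate 'X. *)
Definition LS (n : nat) (v : word) : {poly int} :=
  (\sum_(t in R n v) 'X^(ls (word_of t)))%R.

Definition RS (n : nat) (v : word) : {poly int} :=
  (\sum_(t in R n v) 'X^(rs (word_of t)))%R.

(* Binomial coefficient with integer top a >= -1, where 'C(-1, 0) = 1; the
   value 0 for a < 0 < k is a dummy. *)
Definition binz (a : int) (k : nat) : nat :=
  if k is 0 then 1 else if a is Posz m then 'C(m, k) else 0.

(* Main.v *)
(** An RGF [1 :: w] is determined by the positions of the letters of [w] other
than 1 and by the RGF [u] obtained from these letters by subtracting 1; it
avoids [1(v+1)] iff [u] avoids [v].  Each letter of [w] other than 1 gains 1 in
ls, and gains 1 in rs exactly when it stands before the last 1.  Splitting off
the last letter of the position pattern gives both binomial counts. *)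
Require Import Defs.
From mathcomp Require Import all_boot all_order all_algebra.
From mathcomp Require Import zify.
Import GRing.Theory.
Local Open Scope nat_scope.

(** * Removing the 1s of a word and reinserting them *)

Definition non1 (x : nat) : bool := x != 1.

Definition strip (w : word) : word := [seq x.-1 | x <- w & non1 x].

Lemma strip_cons (x : nat) (w : word) :
  strip (x :: w) = if non1 x then x.-1 :: strip w else strip w.
Proof. by rewrite /strip /=; case: ifP. Qed.

(** Inverse of the map sending a word [w] of positive letters to the pair of [map non1 w] and
    [strip w]. The default 0 is read only when [u] has too few letters. *)
Fixpoint weave (b : seq bool) (u : word) : word :=
  match b with
  | [::] => [::]
  | true :: b' => (head 0 u).+1 :: weave b' (behead u)
  | false :: b' => 1 :: weave b' u
  end.

(** The length condition avoids the default of [weave]; positivity of [u] makes every raised letter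
    differ from 1, so pattern and letters can be read back. *)
Lemma weaveK (b : seq bool) (u : word) :
  size u = count id b -> all (leq 1) u ->
  [/\ strip (weave b u) = u, map non1 (weave b u) = b
    & all (leq 1) (weave b u)].
Proof.
elim: b u => [|[] b IH] u /=; first by case: u.
- case: u => //= x u [su] /andP[x0 u0].
  have [e1 e2 e3] := IH u su u0.
  have nx : non1 x.+1 by rewrite /non1 eqSS -lt0n.
  by rewrite strip_cons nx /= e1 e2 e3.
- rewrite add0n => su u0; have [e1 e2 e3] := IH u su u0.
  by rewrite strip_cons /= e1 e2.
Qed.

Lemma stripK (w : word) :
  all (leq 1) w -> weave (map non1 w) (strip w) = w.
Proof.
elim: w => //= x w IH /andP[x0 /IH {}IH].
rewrite strip_cons; have [nx|/negbNE/eqP ->] := boolP (non1 x) => /=.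
  by rewrite IH prednK.
by rewrite IH.
Qed.

Lemma size_strip (w : word) : size (strip w) = count id (map non1 w).
Proof. by rewrite size_map size_filter count_map. Qed.

Lemma strip_rcons (w : word) (x : nat) :
  strip (rcons w x) = if non1 x then rcons (strip w) x.-1 else strip w.
Proof. by rewrite /strip filter_rcons; case: ifP => _; rewrite ?map_rcons. Qed.

Lemma mem_strip (w : word) (y : nat) :
  all (leq 1) w -> (y \in strip w) = (0 < y) && (y.+1 \in w).
Proof.
move=> /allP w0; apply/mapP/andP => [[x + ->]|[y0 yw]].
  rewrite mem_filter => /andP[nx xw]; have x0 := w0 _ xw.
  by rewrite prednK // xw; move: nx x0; rewrite /non1; lia.
by exists y.+1; rewrite // mem_filter yw andbT /non1 eqSS -lt0n.
Qed.

(** * The statistics ls and rs under removal of the 1s *)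

(** Common form of [ls_at] and [rs_at], with [w] the part of the word before, respectively after,
    the letter [x]. *)
Definition smaller (w : word) (x : nat) : nat :=
  size (undup [seq y <- w | y < x]).

Lemma smaller1 (w : word) : all (leq 1) w -> smaller w 1 = 0.
Proof.
move=> /allP w0; apply/eqP; rewrite size_eq0; apply/eqP.
case e: (undup _) => [//|y s].
have : y \in undup [seq y <- w | y < 1] by rewrite e mem_head.
by rewrite mem_undup mem_filter => /andP[+ /w0]; case: y {e}.
Qed.

(** The values of [w] below [x] are 1, if it occurs, and the successors of the values of [strip w]
    below [x.-1]. *)
Lemma smaller_strip (w : word) (x : nat) :
  all (leq 1) w -> 1 < x ->
  smaller w x = (1 \in w) + smaller (strip w) x.-1.
Proof.
move=> w0 x1.
set s := undup [seq y <- strip w | y < x.-1].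
have -> : (1 \in w) + smaller (strip w) x.-1
    = size (nseq (1 \in w) 1 ++ map S s).
  by rewrite size_cat size_nseq size_map.
apply/perm_size/uniq_perm; first exact: undup_uniq.
  rewrite cat_uniq map_inj_uniq ?undup_uniq ?andbT //; last exact: succn_inj.
  apply/andP; split; first by case: (1 \in w).
  apply/hasP => -[_ /mapP[y ys ->]]; rewrite /= mem_nseq eqSS => /andP[_ /eqP y0].
  by move: ys; rewrite mem_undup mem_filter mem_strip // y0 andbF.
move=> y; rewrite mem_cat mem_nseq mem_undup mem_filter lt0b.
case: y => [|[|y]].
- rewrite andbF /=; have /negbTE -> : 0 \notin w by apply/negP => /(allP w0).
  by rewrite andbF; apply/esym/mapP => -[].
- rewrite x1 eqxx andbT /=; case: (1 \in w) => //=; apply/esym/mapP => -[z + [z0]].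
  by rewrite -z0 mem_undup mem_filter mem_strip //= andbF.
- rewrite andbF /= mem_map; last exact: succn_inj.
  rewrite mem_undup mem_filter mem_strip //=; congr (_ && _); lia.
Qed.

Lemma ls_rcons (w : word) (x : nat) : ls (rcons w x) = ls w + smaller w x.
Proof.
rewrite /ls size_rcons big_ord_recr /=; congr (_ + _).
  apply: eq_bigr => i _; rewrite /ls_at nth_rcons ltn_ord -cats1 takel_cat //.
  exact: ltnW.
by rewrite /ls_at nth_rcons ltnn eqxx -cats1 take_size_cat.
Qed.

Lemma rs_cons (x : nat) (w : word) : rs (x :: w) = smaller w x + rs w.
Proof.
rewrite /rs big_ord_recl /=; congr (_ + _).
by rewrite /rs_at /= drop0.
Qed.

(** The leading 1 is one extra smaller value to the left of each letter other than 1, and the 1s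
    contribute nothing. Induction from the right, since ls looks left. *)
Lemma ls_strip (w : word) :
  all (leq 1) w -> ls (1 :: w) = count id (map non1 w) + ls (strip w).
Proof.
elim/last_ind: w => [|w x IH].
  by rewrite /ls /= big_ord_recl !big_ord0.
rewrite all_rcons => /andP[x0 w0]; rewrite -rcons_cons ls_rcons IH //.
rewrite strip_rcons map_rcons -cats1 count_cat /=.
have [nx|/negbNE/eqP ->] := boolP (non1 x); last by rewrite smaller1 ?addn0 //= w0.
rewrite ls_rcons smaller_strip /=; first 1 last.
- by rewrite w0.
- by move: x0 nx; rewrite /non1; lia.
by rewrite strip_cons /=; lia.
Qed.

Fixpoint trues_before_last_false (b : seq bool) : nat :=
  if b is c :: b' then
    (c && (false \in b')) + trues_before_last_false b'
  else 0.

(** A letter other than 1 loses one smaller value on its right exactly when some 1 follows it.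
    Induction from the left, since rs looks right. *)
Lemma rs_strip (w : word) :
  all (leq 1) w -> rs w = trues_before_last_false (map non1 w) + rs (strip w).
Proof.
elim: w => [|x w IH] /=; first by rewrite /rs big_ord0.
case/andP=> x0 w0; rewrite rs_cons IH //.
rewrite strip_cons; have [nx|/negbNE/eqP ->] := boolP (non1 x); last by rewrite smaller1.
rewrite /= rs_cons smaller_strip //; last first.
  by move: x0 nx; rewrite /non1; lia.
suff -> : (false \in map non1 w) = (1 \in w) by lia.
by apply/mapP/idP => [[y yw]|w1]; [rewrite /non1; case: eqP yw => // -> | exists 1].
Qed.

(** * Restricted growth under removal of the 1s *)

Lemma is_rgf_rcons (w : word) (x : nat) :
  is_rgf (rcons w x) = is_rgf w && (0 < x <= 1 + \max_(y <- w) y).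
Proof.
rewrite /is_rgf all_rcons size_rcons /=.
case: w => [|a w]; first by rewrite /= big_nil !andbT; lia.
set s := a :: w.
have -> : iota 1 (size w).+1 = rcons (iota 1 (size w)) (size w).+1.
  by have := iotaD 1 (size w) 1; rewrite addn1 cats1 add1n.
rewrite all_rcons nth_rcons ltnn eqxx -cats1 take_size_cat //=.
have -> : all (fun i => nth 0 (s ++ [:: x]) i <= 1 + \max_(y <- take i (s ++ [:: x])) y)
    (iota 1 (size w))
  = all (fun i => nth 0 s i <= 1 + \max_(y <- take i s) y) (iota 1 (size w)).
  apply: eq_in_all => i; rewrite mem_iota add1n => /andP[_ lti].
  by rewrite nth_cat lti takel_cat // ltnW.
by rewrite -!andbA; do !bool_congr.
Qed.

Lemma max_strip (w : word) :
  all (leq 1) w -> \max_(y <- 1 :: w) y = (\max_(y <- strip w) y).+1.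
Proof.
elim/last_ind: w => [|w x IH]; first by rewrite big_cons !big_nil.
rewrite all_rcons => /andP[x0 /IH {}IH].
rewrite -rcons_cons -cats1 big_cat big_seq1 IH strip_rcons.
case: ifP => [nx|/eqP ->]; last by rewrite /=; lia.
by rewrite -[in RHS]cats1 big_cat big_seq1 /=; lia.
Qed.

Lemma is_rgf_all_pos (w : word) : is_rgf w -> all (leq 1) w.
Proof. by case/and3P. Qed.

(** An appended 1 is always allowed. For any other positive letter, the letter and the maximum both
    drop by 1, so the growth bound is the same on both sides. *)
Lemma is_rgf_strip (w : word) :
  is_rgf (1 :: w) = all (leq 1) w && is_rgf (strip w).
Proof.
elim/last_ind: w => // w x IH.
rewrite -rcons_cons is_rgf_rcons IH all_rcons strip_rcons.
have [w0|] := boolP (all (leq 1) w); last by rewrite !andbF.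
rewrite max_strip //; case: ifP => [nx|/eqP ->]; last by rewrite /= andbT.
rewrite is_rgf_rcons andbT /=; move: nx; rewrite /non1.
case: (is_rgf (strip w)); rewrite /= ?andbF //; lia.
Qed.

(** * Standardization and pattern containment *)

Lemma standardize_cons_min (a : nat) (u : word) :
  all (ltn a) u -> standardize (a :: u) = 1 :: shift 1 (standardize u).
Proof.
move=> au; have au' : a \notin u by apply/negP => /(allP au); rewrite /= ltnn.
rewrite /standardize /shift /= (negbTE au') /=.
(* Both sides are sorted and are permutations of each other. *)
have -> : sort leq (a :: undup u) = a :: sort leq (undup u).
  apply: (sorted_eq leq_trans anti_leq); first exact/sort_sorted/leq_total.
    rewrite /= path_min_sorted; first exact/sort_sorted/leq_total.
    by apply/allP => y; rewrite mem_sort mem_undup => /(allP au) /ltnW.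
  by rewrite perm_sort perm_cons perm_sym perm_sort.
rewrite /= eqxx; congr (_ :: _); rewrite -map_comp; apply/eq_in_map => x xu /=.
by case: eqP xu au' => [<- ->|_ _ _] //; rewrite addn1.
Qed.

Lemma standardize_map_succ (u : word) :
  standardize (map S u) = standardize u.
Proof.
rewrite /standardize undup_map_inj; last exact: succn_inj.
rewrite sort_map -map_comp; apply: eq_map => x /=.
by rewrite index_map //; exact: succn_inj.
Qed.

Lemma index_sort_min (s : word) (a y : nat) :
  index a (sort leq s) = 0 -> y \in s -> a <= y.
Proof.
rewrite -(mem_sort leq); have := sort_sorted leq_total s.
case: (sort leq s) => //= x t; case: eqP => // -> {x} pt _.
rewrite inE => /orP[/eqP -> //|yt].
by move: pt; rewrite (path_sortedE leq_trans) => /andP[/allP/(_ _ yt)].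
Qed.

(** In a copy of 1(v+1) all letters after the first exceed it, hence exceed 1 and survive in
    [strip w]. Conversely, the leading 1 extends any copy of [v] found there. *)
Lemma contains_strip (w v : word) :
  all (leq 1) w -> all (leq 1) v ->
  contains (1 :: w) (1 :: shift 1 v) = contains (strip w) v.
Proof.
move=> w0 v0; apply/containsP/containsP => [[[//|a u] su eqv]|[u su uv]].
- have su' := mem_subseq su.
  have ua : all (ltn a) u.
    move: eqv => [ia euv]; apply/allP => y yu.
    have : (index y (sort leq (undup (a :: u)))).+1 \in shift 1 v.
      by rewrite -euv; apply: map_f.
    case/mapP => z /(allP v0) z0 eyz.
    (* [a] standardizes to 1, so it is minimal; [y] standardizes to at least 2, so the inequality is
       strict. *)
    have ya := index_sort_min (undup (a :: u)) a y ia.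
    rewrite /= ltn_neqAle ya ?andbT ?mem_undup ?inE ?yu ?orbT //.
    by apply/eqP => eay; rewrite -eay ia in eyz; lia.
  have a1 : 0 < a by move: (su' a (mem_head _ _)); rewrite inE => /orP[/eqP ->|/(allP w0)].
  move: eqv; rewrite standardize_cons_min // => -[/inj_map euv].
  have {}euv : standardize u = v by apply: euv => x y; rewrite !addn1 => -[].
  (* Either [a] is matched with the leading 1, or all of [a :: u] lies in [w]. *)
  have uw : subseq u w.
    by move: su; rewrite /=; case: eqP => // _; apply: subseq_trans (subseq_cons _ _).
  exists (map predn u).
    rewrite /strip; apply: map_subseq; rewrite subseq_filter uw andbT.
    by apply/allP => y /(allP ua) /=; rewrite /non1; lia.
  rewrite -euv -standardize_map_succ -map_comp; congr standardize.
  rewrite -[RHS]map_id; apply/eq_in_map => y /(allP ua) /= ay.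
  by rewrite prednK //; lia.
- exists (1 :: map S u).
    rewrite /=; apply: subseq_trans (filter_subseq non1 w).
    have -> : filter non1 w = map S (strip w).
      rewrite -map_comp -[LHS]map_id; apply/eq_in_map => y.
      by rewrite mem_filter => /andP[_ /(allP w0)] /= y0; rewrite prednK.
    exact: map_subseq.
  rewrite standardize_cons_min ?standardize_map_succ ?uv //.
  apply/allP => _ /mapP[y yu ->]; have := mem_subseq su yu.
  by rewrite mem_strip // => /andP[].
Qed.

(** * Decomposition of the avoiding RGFs by position pattern *)

(** Tuples of different lengths have different types; as plain words, the RGFs of all lengths can be
    compared and rearranged in one list. *)
Definition rgf_words (n : nat) (v : word) : seq word :=
  [seq word_of t | t in R n v].

Lemma mem_rgf_words (n : nat) (v w : word) :
  (w \in rgf_words n v) = [&& size w == n, is_rgf w & avoids w v].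
Proof.
apply/imageP/and3P => [[t tR ->]|[/eqP sw rw aw]].
  have [] : [/\ size (word_of t) = n, is_rgf (word_of t) & avoids (word_of t) v].
    by apply/mem_R; exists t.
  by move=> /eqP.
by have /mem_R[t tR <-] : [/\ size w = n, is_rgf w & avoids w v] by []; exists t.
Qed.

Lemma rgf_words_uniq (n : nat) (v : word) : uniq (rgf_words n v).
Proof.
rewrite map_inj_uniq ?enum_uniq // => s t /inj_map st.
by apply/val_inj/st/val_inj.
Qed.

(** Built by appending on the right, so that the sums over patterns split by their last bit. *)
Fixpoint bit_words (n : nat) : seq (seq bool) :=
  if n is m.+1 then
    map (rcons^~ true) (bit_words m) ++ map (rcons^~ false) (bit_words m)
  else [:: [::]].

Lemma mem_bit_words (n : nat) (b : seq bool) :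
  (b \in bit_words n) = (size b == n).
Proof.
elim: n b => [|n IH] b; first by rewrite inE size_eq0.
rewrite /= mem_cat; elim/last_ind: b => [|b c _].
  by apply/norP; split; apply/mapP => -[[]].
rewrite size_rcons eqSS -IH; apply/orP/idP => [[]|bn].
- by case/mapP => d dn /rcons_inj [-> _].
- by case/mapP => d dn /rcons_inj [-> _].
- by case: c; [left|right]; apply: map_f.
Qed.

Lemma bit_words_uniq (n : nat) : uniq (bit_words n).
Proof.
elim: n => //= n IH.
rewrite cat_uniq !map_inj_uniq ?IH ?andbT /=; try exact: rcons_injl.
by apply/hasP => -[_ /mapP[b _ ->]] /mapP[d _ /rcons_inj []].
Qed.

Lemma rgf_words_cons (n : nat) (v : word) :
  is_rgf v ->
  perm_eq (rgf_words n.+1 (1 :: shift 1 v))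
    [seq 1 :: weave b u | b <- bit_words n, u <- rgf_words (count id b) v].
Proof.
move=> /is_rgf_all_pos v0.
have memP b u : u \in rgf_words (count id b) v ->
    [/\ strip (weave b u) = u, map non1 (weave b u) = b
      & all (leq 1) (weave b u)].
  rewrite mem_rgf_words => /and3P[/eqP su ru _].
  by apply: weaveK => //; apply: is_rgf_all_pos.
apply: uniq_perm; first exact: rgf_words_uniq.
  apply: allpairs_uniq_dep => [|b _|].
  - exact: bit_words_uniq.
  - exact: rgf_words_uniq.
  (* Injectivity: [strip] and [map non1] recover [u] and [b] from the woven word. *)
  move=> _ _ /allpairsPdep[b [u [_ ub ->]]] /allpairsPdep[c [t [_ tc ->]]] /=.
  have [e1 e2 _] := memP _ _ ub; have [f1 f2 _] := memP _ _ tc.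
  by case=> ebt; rewrite -e1 ebt f1 -e2 ebt f2.
move=> w; rewrite mem_rgf_words; apply/and3P/allpairsPdep => [[]|[b [u [bn ub ->]]]].
- case: w => // x w /eqP[sw] rw aw.
  have /eqP/= x1 : head 1 (x :: w) == 1 by case/and3P: rw.
  rewrite {x}x1 in rw aw *.
  have := rw; rewrite is_rgf_strip => /andP[w0 rsw].
  exists (map non1 w), (strip w).
  rewrite mem_bit_words size_map sw eqxx mem_rgf_words size_strip eqxx rsw.
  by rewrite stripK //; split=> //; rewrite /avoids -contains_strip.
- have [e1 e2 e3] := memP _ _ ub.
  move: ub; rewrite mem_rgf_words => /and3P[_ ru au].
  rewrite is_rgf_strip e1 e3 ru /avoids contains_strip // e1.
  by rewrite /= eqSS -(size_map non1) e2 -mem_bit_words.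
Qed.

(** * Counting position patterns by binomial coefficients *)

(** A final [true] has no [false] after it and changes nothing; a final [false] puts every [true]
    before it. *)
Lemma trues_before_last_false_rcons (b : seq bool) (c : bool) :
  trues_before_last_false (rcons b c)
  = if c then trues_before_last_false b else count id b.
Proof.
elim: b => [|d b /= ->]; first by case: c.
by rewrite mem_rcons inE; case: c d => [] [].
Qed.

Local Open Scope ring_scope.

Lemma sum_bit_words_count (V : nmodType) (n : nat) (G : nat -> V) :
  \sum_(b <- bit_words n) G (count id b)
  = \sum_(0 <= j < n.+1) G j *+ 'C(n, j).
Proof.
elim: n G => [|n IH] G; first by rewrite big_seq1 big_nat1.
rewrite /= big_cat !big_map /=.
under eq_bigr do rewrite -cats1 count_cat /= addn1.
under [X in _ + X]eq_bigr do rewrite -cats1 count_cat /= !addn0.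
rewrite (IH (fun j => G j.+1)) (IH G) [RHS]big_nat_recl //.
(* Pascal's rule: the two summands count the patterns ending in [false] and in [true]. *)
under [in RHS]eq_bigr do rewrite binS mulrnDr.
rewrite big_split /= addrA [LHS]addrC; congr (_ + _).
transitivity (\sum_(0 <= j < n.+2) G j *+ 'C(n, j)).
  by rewrite [RHS]big_nat_recr //= bin_small // mulr0n addr0.
by rewrite [LHS]big_nat_recl // !bin0.
Qed.

(** Patterns ending in [false] give the diagonal terms [k = j], with coefficient ['C(n, j)] at
    length [n.+1]; those ending in [true] give the terms [k < j] by induction. *)
Lemma sum_bit_words (V : nmodType) (n : nat) (G : nat -> nat -> V) :
  \sum_(b <- bit_words n) G (count id b) (trues_before_last_false b)
  = \sum_(0 <= j < n.+1) \sum_(0 <= k < j.+1)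
      G j k *+ binz (n.+1%:Z + k%:Z - j%:Z - 2%:Z) k.
Proof.
(* For the empty pattern the binomial has top -1 and [k = 0], hence value 1. *)
elim: n G => [|n IH] G; first by rewrite big_seq1 !big_nat1.
rewrite /= big_cat !big_map /=.
under eq_bigr do rewrite trues_before_last_false_rcons -cats1 count_cat /= addn1.
under [X in _ + X]eq_bigr do
  rewrite trues_before_last_false_rcons -cats1 count_cat /= !addn0.
rewrite (IH (fun j k => G j.+1 k)) (sum_bit_words_count _ _ (fun j => G j j)).
have binzE j : binz (n.+2%:Z + j%:Z - j%:Z - 2%:Z) j = 'C(n, j).
  have -> : (n.+2%:Z + j%:Z - j%:Z - 2%:Z = n%:Z)%R by lia.
  by case: j => //=; rewrite bin0.
under [RHS]eq_bigr do rewrite big_nat_recr //= binzE.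
rewrite big_split /=; congr (_ + _); last first.
  by rewrite [RHS]big_nat_recr //= bin_small // mulr0n addr0.
(* The row [j = 0] has no term with [k < j]. Replacing [j] by [j.+1] then lowers the top exactly as
   passing from length [n.+1] to [n] does. *)
rewrite [RHS]big_nat_recl // [X in _ = X + _]big_geq // add0r.
apply: eq_bigr => j _; apply: eq_bigr => k _; congr (_ *+ binz _ _).
by lia.
Qed.

(** * Generating functions *)

(** The bijection of [rgf_words_cons] applied to an arbitrary weight [F], to serve both ls and
    rs. *)
Lemma sum_R_cons (V : nmodType) (n : nat) (v : word) (F : word -> V) :
  is_rgf v ->
  \sum_(t in R n.+1 (1%N :: shift 1 v)) F (word_of t)
  = \sum_(b <- bit_words n) \sum_(t in R (count id b) v)
      F (1%N :: weave b (word_of t)).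
Proof.
move=> rv.
have sumE m u (H : word -> V) :
    \sum_(t in R m u) H (word_of t) = \sum_(w <- rgf_words m u) H w.
  by rewrite big_map -big_enum.
rewrite sumE (perm_big _ (rgf_words_cons n v rv)) big_allpairs_dep.
by apply: eq_bigr => b _; rewrite -(sumE _ _ (fun w => F (1%N :: weave b w))).
Qed.

Lemma LS_cons (n : nat) (v : word) :
  is_rgf v ->
  LS n.+1 (1%N :: shift 1 v)
  = \sum_(b <- bit_words n) 'X^(count id b) * LS (count id b) v.
Proof.
move=> rv; rewrite /LS (sum_R_cons _ _ _ (fun w => 'X^(ls w))) //.
apply: eq_bigr => b _; rewrite mulr_sumr; apply: eq_bigr => t.
rewrite inE => /andP[/is_rgf_all_pos t0 _].
have [||e1 e2 e3] := weaveK b (word_of t) => //.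
  by rewrite size_map size_tuple.
by rewrite ls_strip // e1 e2 exprD.
Qed.

Lemma RS_cons (n : nat) (v : word) :
  is_rgf v ->
  RS n.+1 (1%N :: shift 1 v)
  = \sum_(b <- bit_words n)
      'X^(trues_before_last_false b) * RS (count id b) v.
Proof.
move=> rv; rewrite /RS (sum_R_cons _ _ _ (fun w => 'X^(rs w))) //.
apply: eq_bigr => b _; rewrite mulr_sumr; apply: eq_bigr => t.
rewrite inE => /andP[/is_rgf_all_pos t0 _].
have [||e1 e2 e3] := weaveK b (word_of t) => //.
  by rewrite size_map size_tuple.
(* The leading 1 has no smaller value on its right, so it adds 0 to rs. *)
by rewrite rs_cons smaller1 // rs_strip // e1 e2 add0n exprD.
Qed.

Theorem theorem4p1 (v : word) (n : nat) (hv : is_rgf v) (hn : (1 <= n)%N) :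
  LS n (1%N :: shift 1 v) =
    \sum_(0 <= j < n) ('C(n.-1, j))%:R * 'X^j * LS j v
  /\
  RS n (1%N :: shift 1 v) =
    \sum_(0 <= j < n) \sum_(0 <= k < j.+1)
      (binz (n%:Z + k%:Z - j%:Z - 2%:Z) k)%:R * 'X^k * RS j v.
Proof.
case: n hn => // n _; split.
- rewrite LS_cons // (sum_bit_words_count _ _ (fun j => 'X^j * LS j v)).
  by apply: eq_bigr => j _; rewrite -mulrA mulr_natl.
- rewrite RS_cons // (sum_bit_words _ _ (fun j k => 'X^k * RS j v)).
  apply: eq_bigr => j _; apply: eq_bigr => k _.
  by rewrite -mulrA mulr_natl.
Qed.
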